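(* Let $G=(V,E)$ be a graph on $n\ge 4$ vertices that does not contain a universal line. Then $G$ induces at least $n$ distinct lines. Moreover, $G$ induces exactly $n$ distinct lines only if $G$ consists of a clique of size $n-1$ together with one further vertex that has at most one neighbor in the clique.
   Context: Graphs are finite, simple and undirected. For a graph $G=(V,E)$ and two distinct vertices $a,b\in V$, the line $\overline{ab}$ is the subset of $V$ defined by $\overline{ab}=\{a,b\}\cup\{c\in V: abc\text{ is a triangle of }G\}$, where $abc$ is a triangle if $a,b,c$ are distinct and pairwise adjacent. (In particular $\overline{ab}=\{a,b\}$ if $ab\notin E$.) The lines induced by $G$ are the sets $\overline{ab}$ over all pairs of distinct vertices $a,b$; two lines are distinct if they differ as subsets of $V$. A line is universal if it equals $V$. *)

(* Defs.v *)
From mathcomp Require Import all_boot.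

Set Implicit Arguments.
Unset Strict Implicit.
Unset Printing Implicit Defensive.

(* A finite simple graph is a symmetric, irreflexive adjacency
   relation [e : rel T] on the finite type [T] of its vertices. *)

Definition triangle (T : finType) (e : rel T) (a b c : T) : bool :=
  [&& a != b, a != c, b != c, e a b, e a c & e b c].

Definition line (T : finType) (e : rel T) (a b : T) : {set T} :=
  [set a; b] :|: [set c | triangle e a b c].

(* A set of sets, so its cardinal counts distinct lines. *)
Definition lines (T : finType) (e : rel T) : {set {set T}} :=
  [set line e p.1 p.2 | p : T * T & p.1 != p.2].

Definition universal (T : finType) (L : {set T}) : bool := L == [set: T].

Definition clique (T : finType) (e : rel T) (K : {set T}) : Prop :=
  {in K &, forall x y : T, x != y -> e x y}.

Definition neighbors_in (T : finType) (e : rel T) (v : T) (K : {set T}) :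
    {set T} :=
  [set x in K | e v x].

(* Main.v *)
(** Pass to the complement [h] of [G].  A non-edge of [G] is its own line, and
    the line of an edge [ab] of [G] is the complement of [N a :|: N b], where
    [N] is the neighbourhood in [h].  So [G] has [m + s] lines, where [m] is
    the number of edges of [h] and [s] the number of distinct unions
    [N a :|: N b] over the non-adjacent pairs; that no line is universal means
    that [h] has at most one isolated vertex.  If [h] has [c] components then
    [n <= m + c].  If [z] is isolated, or if there are no isolated vertices,
    each component not containing [z] has two adjacent vertices [r], [r'], and
    the sets [N z :|: N r], [N z :|: N r'] are pairwise distinct, so
    [s >= 2 (c - 1)].  What remains are small cases: if [s = 2] and [z] is
    isolated, [h] minus [z] is complete bipartite; if [s = 1] and no vertex is
    isolated, [h] has a vertex adjacent to all the others; in both cases the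
    edge count forces a star. *)
Require Import Defs.
From mathcomp Require Import all_boot.
From mathcomp Require Import zify.

Set Implicit Arguments.
Unset Strict Implicit.
Unset Printing Implicit Defensive.

Lemma set2_eq (T : finType) (a b c d : T) :
  [set a; b] = [set c; d] -> a = c /\ b = d \/ a = d /\ b = c.
Proof.
move=> E.
have /set2P ha : a \in [set c; d] by rewrite -E set21.
have /set2P hb : b \in [set c; d] by rewrite -E set22.
have /set2P hc : c \in [set a; b] by rewrite E set21.
have /set2P hd : d \in [set a; b] by rewrite E set22.
by case: ha => Ea; [left | right]; split=> //; case: hb; case: hc; case: hd;
  congruence.
Qed.

(** * Edges and components *)

Section Graph.

Variables (T : finType) (h : rel T).
Hypotheses (h_sym : symmetric h) (h_irr : irreflexive h).

Definition nbhd (a : T) : {set T} := [set x | h a x].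

Definition edges : {set {set T}} :=
  [set [set p.1; p.2] | p : T * T & h p.1 p.2].

Definition nbhd_unions : {set {set T}} :=
  [set nbhd p.1 :|: nbhd p.2 | p : T * T & (p.1 != p.2) && ~~ h p.1 p.2].

Definition comp_roots : {set T} := [set x | root h x == x].

Lemma mem_edges a b : h a b -> [set a; b] \in edges.
Proof. by move=> hab; apply/imsetP; exists (a, b); rewrite ?inE. Qed.

Lemma mem_nbhd_unions a b :
  a != b -> ~~ h a b -> nbhd a :|: nbhd b \in nbhd_unions.
Proof. by move=> ab hab; apply/imsetP; exists (a, b); rewrite ?inE ?ab. Qed.

Lemma h_csym : connect_sym h.
Proof. exact: sym_connect_sym. Qed.

Lemma root_in_comp_roots x : root h x \in comp_roots.
Proof. by rewrite inE (root_root h_csym). Qed.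

(** Take [U] maximal among the sets that contain all roots and have at most as many vertices as
    inner edges plus roots. An edge leaving [U] would bring one new vertex and a new inner edge, so
    [U] is closed under [h]; as it meets every component, it is everything. *)
Lemma leq_card_edges_roots : #|T| <= #|edges| + #|comp_roots|.
Proof.
pose inner (U : {set T}) := [set L in edges | L \subset U].
pose P (U : {set T}) :=
  (comp_roots \subset U) && (#|U| <= #|inner U| + #|comp_roots|).
have P0 : P comp_roots by rewrite /P subxx leq_addl.
case: (@maxset_exists _ P _ P0) => U /maxsetP[/andP[RU leU] maxU] _.
have [UT|[x xU]] : U = setT \/ exists x, x \notin U.
- case: (eqVneq U setT) => [|UT]; first by left.
  by right; apply/existsP; rewrite -negb_forall; apply: contraNN UT => /forallP Ux;
    apply/eqP/setP => y; rewrite Ux inE.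
- rewrite -cardsT -UT; apply: leq_trans leU _.
  by rewrite leq_add2r subset_leq_card //; apply/subsetP => L; rewrite inE => /andP[].
have [[u v] /= /and3P[uU vU huv]|noE] :=
  pickP [pred p : T * T | [&& p.1 \in U, p.2 \notin U & h p.1 p.2]].
- have eqU : v |: U = U.
    apply: maxU; last exact: subsetUr.
    rewrite /P (subset_trans RU) ?subsetUr //= cardsU1 vU.
    apply: leq_trans (_ : #|[set u; v] |: inner U| + #|comp_roots| <= _).
      rewrite cardsU1 inE mem_edges //= subUset !sub1set (negPf vU) andbF /=.
      by rewrite -addnA leq_add2l.
    rewrite leq_add2r subset_leq_card //; apply/subsetP => L.
    rewrite !inE => /orP[/eqP->|/andP[-> LU]] /=.
      by rewrite mem_edges // subUset !sub1set !inE uU eqxx orbT.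
    by rewrite (subset_trans LU) // subsetUr.
  by move: vU; rewrite -eqU setU11.
have clU : closed h (mem U).
  apply: (intro_closed h_csym) => a b hab aU.
  by have := noE (a, b); rewrite /= aU hab andbT => /negbFE.
have := closed_connect clU (connect_root h x).
by rewrite [x \in _](negPf xU) (subsetP RU) // root_in_comp_roots.
Qed.

(** * Unions with a fixed vertex *)

Definition unions_at (z : T) : {set {set T}} :=
  [set nbhd z :|: nbhd a | a in [set a | ~~ connect h z a]].

Lemma unions_at_sub z : unions_at z \subset nbhd_unions.
Proof.
apply/subsetP => L /imsetP[a]; rewrite inE => za ->.
apply: mem_nbhd_unions; first by apply: contraNneq za => ->; apply: connect0.
by apply: contraNN za => /connect1.
Qed.

Lemma leq_roots_unions_at z :
    (forall x, x != z -> exists y, h x y) ->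
  #|comp_roots|.-1.*2 <= #|unions_at z|.
Proof.
move=> nisol.
(* The default [r] is never reached for the roots occurring in [D]: they differ from [z] and so have
   a neighbour. *)
pose nb r := odflt r [pick y | h r y].
pose end_ (p : T * bool) := if p.2 then p.1 else nb p.1.
pose D := setX (comp_roots :\ root h z) [set: bool].
have hnb r : r != z -> h r (nb r).
  move=> /nisol[y hy]; rewrite /nb; case: pickP => //= no.
  by have := no y; rewrite hy.
have nzr r : r \in comp_roots :\ root h z -> ~~ connect h z r.
  rewrite !inE => /andP[rz /eqP rr]; apply: contraNN rz.
  by rewrite -(root_connect h_csym) rr eq_sym.
have nez r : r \in comp_roots :\ root h z -> r != z.
  by move=> /nzr; apply: contraNneq => ->; apply: connect0.
have inD p : (p \in D) = (p.1 \in comp_roots :\ root h z).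
  by case: p => r b; rewrite in_setX [b \in _]inE andbT.
have cend p : p \in D -> connect h p.1 (end_ p).
  rewrite inD => /nez /hnb hp; rewrite /end_.
  by case: p.2; [apply: connect0 | apply: connect1].
have endz p : p \in D -> ~~ connect h z (end_ p).
  move=> pD; have := pD; rewrite inD => /nzr.
  apply: contraNN => zp; apply: connect_trans zp _.
  by rewrite h_csym cend.
have -> : #|comp_roots|.-1.*2 = #|D|.
  rewrite cardsX cardsT card_bool muln2.
  by rewrite (cardsD1 (root h z) comp_roots) root_in_comp_roots.
rewrite -(card_in_imset (f := fun p => nbhd z :|: nbhd (end_ p))).
  apply: subset_leq_card; apply/subsetP => L /imsetP[p pD ->].
  by apply/imsetP; exists (end_ p); rewrite // inE endz.
move=> p q pD qD Epq.
have Epq1 : p.1 = q.1.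
  (* Such a [y] lies in both unions. It is not adjacent to [z], hence it joins [end_ p] to
     [end_ q]. *)
  have [y hy] : exists y, h (end_ p) y.
    by apply: nisol; apply: contraNneq (endz p pD) => ->; apply: connect0.
  have : y \in nbhd z :|: nbhd (end_ q) by rewrite -Epq !inE hy orbT.
  rewrite !inE => /orP[hzy|hqy].
    case/negP: (endz p pD); apply: connect_trans (connect1 hzy) _.
    by apply: connect1; rewrite h_sym.
  have : connect h p.1 q.1.
    apply: connect_trans (cend p pD) _; apply: connect_trans (connect1 hy) _.
    rewrite h_csym; apply: connect_trans (cend q qD) _; exact: connect1.
  move: pD qD; rewrite !inD !inE => /andP[_ /eqP rp] /andP[_ /eqP rq].
  by rewrite -(root_connect h_csym) rp rq => /eqP.
(* [nb r] tells the two unions apart: it is in [nbhd r], but neither in [nbhd z] nor in its own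
   neighbourhood. *)
have key r : r \in comp_roots :\ root h z ->
    nbhd z :|: nbhd r <> nbhd z :|: nbhd (nb r).
  move=> rR E; have hr := hnb r (nez r rR).
  have : nb r \in nbhd z :|: nbhd (nb r) by rewrite -E !inE hr orbT.
  rewrite !inE h_irr orbF => hz; case/negP: (nzr r rR).
  by apply: connect_trans (connect1 hz) _; apply: connect1; rewrite h_sym.
move: p q pD qD Epq Epq1 => [r b] [s d] /=; rewrite !inD /= => rR _ + rs; subst s; rewrite /end_ /=; case: b; case: d => // E.
  by case: (key r rR).
by case: (key r rR).
Qed.

(** * Extremal cases: stars *)

(** The extremal structure seen in the complement: the first clause makes the vertices other than
    [v] a clique of $G$, the second leaves [v] at most one neighbour in it. *)
Definition star_like : Prop :=
  exists v : T, (forall p q, h p q -> p = v \/ q = v) /\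
    (forall p q, p != v -> q != v -> ~~ h v p -> ~~ h v q -> p = q).

(** [A] and [B] are the sides of a complete bipartite graph on the vertices other than [z]. Once [A]
    is a single vertex, it meets every edge, and only [z] can be a further non-neighbour of it. *)
Lemma star_of_two_nbhds z (A B : {set T}) :
    (forall x, ~~ h z x) ->
    (forall x, x \in A -> nbhd x = B) -> (forall x, x \in B -> nbhd x = A) ->
    (forall x, x != z -> x \in A :|: B) -> #|A| = 1 ->
  star_like.
Proof.
move=> zisol nA nB cov /eqP/cards1P[v Av]; subst A.
have nv : nbhd v = B by apply: nA; rewrite set11.
exists v; split=> [p q hpq|].
  have : p \in [set v] :|: B.
    by apply: cov; apply: contraTneq hpq => ->; apply: zisol.
  rewrite !inE => /orP[/eqP|/nB Np]; first by left.
  have : q \in nbhd p by rewrite inE.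
  by rewrite Np inE => /eqP; right.
have isz p : p != v -> ~~ h v p -> p = z.
  move=> pv hvp; apply/eqP; apply: contraTT hvp => /cov.
  by rewrite !inE (negPf pv) -nv inE negbK.
by move=> p q pv qv /(isz p pv)-> /(isz q qv)->.
Qed.

(** As [nbhd z] is empty, each other neighbourhood is itself one of the at most two unions. No
    vertex lies in its own neighbourhood, so the vertices of [A] have neighbourhood [B] and
    conversely. *)
Lemma star_isolated z :
    (forall x, ~~ h z x) -> (forall x, x != z -> exists y, h x y) ->
    4 <= #|T| -> #|nbhd_unions| <= 2 -> #|edges| <= #|T| - 2 ->
  star_like.
Proof.
move=> zisol nisol n4 leS leE.
have Nz : nbhd z = set0 by apply/setP => x; rewrite !inE; apply: negbTE.
have [x xz] : exists x, x != z.
  have : 0 < #|[set~ z]| by rewrite cardsC1; lia.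
  by case/card_gt0P => x; rewrite !inE; exists x.
have [y hxy] := nisol x xz.
have nez a b : h a b -> a != z by apply: contraTneq => ->.
have yz : y != z by apply: (nez y x); rewrite h_sym.
have inS a : a != z -> nbhd a \in nbhd_unions.
  by move=> az; rewrite -[nbhd a]set0U -Nz mem_nbhd_unions 1?eq_sym.
pose A := nbhd x; pose B := nbhd y.
have AB : A != B.
  by apply/eqP => /setP/(_ y); rewrite !inE hxy h_irr.
have eS : [set A; B] = nbhd_unions.
  apply/eqP; rewrite eqEcard cards2 AB leS andbT.
  by apply/subsetP => L /set2P[]->; apply: inS.
have dich a : a != z -> nbhd a = A \/ nbhd a = B.
  by move=> /inS; rewrite -eS => /set2P.
have notin a : a \notin nbhd a by rewrite inE h_irr.
have nzN a b : b \in nbhd a -> b != z by rewrite inE h_sym => /nez.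
have nA a : a \in A -> nbhd a = B.
  by move=> aA; case: (dich a (nzN _ _ aA)) => // Na; case/negP: (notin a); rewrite Na.
have nB a : a \in B -> nbhd a = A.
  by move=> aB; case: (dich a (nzN _ _ aB)) => // Na; case/negP: (notin a); rewrite Na.
have cov a : a != z -> a \in A :|: B.
  move=> az; have [b hab] := nisol a az.
  have bz : b != z by apply: (nez b a); rewrite h_sym.
  have : a \in nbhd b by rewrite inE h_sym.
  by case: (dich b bz) => -> ?; apply/setUP; [left | right].
have leAB : #|A| * #|B| <= #|edges|.
  rewrite -cardsX -(card_in_imset (f := fun p => [set p.1; p.2])).
    apply: subset_leq_card; apply/subsetP => L /imsetP[[a b]].
    rewrite in_setX /= => /andP[/nA Na bB] ->; apply: mem_edges.
    by rewrite -Na inE in bB.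
  move=> [a b] [c d]; rewrite !in_setX /= => /andP[aA _] /andP[_ dB].
  (* Exchanged ends would put [d] in both [A] and [B]. *)
  case/set2_eq => [[-> ->] //|[ad _]].
  by case/negP: (notin d); rewrite (nB d dB) -ad.
have leT : #|T|.-1 <= #|A| + #|B|.
  rewrite -(cardsC1 z); apply: leq_trans (_ : #|A :|: B| <= _).
    by apply: subset_leq_card; apply/subsetP => a; rewrite !inE => /cov; rewrite !inE.
  by rewrite cardsU leq_subr.
have A0 : 0 < #|A| by apply/card_gt0P; exists y; rewrite inE.
have B0 : 0 < #|B| by apply/card_gt0P; exists x; rewrite inE h_sym.
(* The bounds give $|A||B| \le |A|+|B|-1$, that is, $(|A|-1)(|B|-1) \le 0$. *)
have [A1|B1] : #|A| = 1 \/ #|B| = 1 by nia.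
  exact: (star_of_two_nbhds zisol nA nB cov).
apply: (star_of_two_nbhds zisol nB nA _ B1) => a /cov.
by rewrite setUC.
Qed.

(** A vertex [w] of the only union [W] is adjacent to all others, since the union for [w] and a
    non-neighbour misses [w]. The $n-1$ edges at [w] then exhaust the edges. *)
Lemma star_one_union :
    (forall x, exists y, h x y) ->
    #|nbhd_unions| = 1 -> #|edges| <= #|T|.-1 ->
  star_like.
Proof.
move=> nisol /eqP/cards1P[W eS] leE.
have uni w x : w \in W -> w != x -> h w x.
  move=> wW wx; apply: contraTT wW => hwx.
  have := mem_nbhd_unions wx hwx; rewrite eS => /set1P <-.
  by rewrite !inE h_irr h_sym.
have [w wW] : exists w, w \in W.
  have : W \in nbhd_unions by rewrite eS set11.
  case/imsetP=> -[a b] _ /= ->; have [y hy] := nisol a.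
  by exists y; rewrite !inE hy.
have eE : [set [set w; x] | x in [set~ w]] = edges.
  apply/eqP; rewrite eqEcard card_in_imset ?cardsC1 ?leE ?andbT.
    apply/subsetP => L /imsetP[x]; rewrite !inE => xw ->.
    by apply: mem_edges; apply: uni; rewrite // eq_sym.
  by move=> x y; rewrite !inE => xw yw /set2_eq[[]|[-> ->]].
exists w; split=> [p q /mem_edges|p q pw _]; last by rewrite uni // eq_sym.
rewrite -eE => /imsetP[x _ /set2_eq[[-> _]|[_ ->]]]; by [left | right].
Qed.

Lemma no_unions_complete :
  4 <= #|T| -> #|nbhd_unions| = 0 -> #|T| < #|edges|.
Proof.
move=> n4 /eqP; rewrite cards_eq0 => /eqP S0.
have comp a b : a != b -> h a b.
  move=> ab; apply/idPn => /(mem_nbhd_unions ab).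
  by rewrite S0 inE.
(* $n(n-1)/2 > n$ from $n = 4$ on. *)
apply: leq_trans (_ : #|[set A : {set T} | #|A| == 2]| <= _).
  rewrite card_draws bin2; nia.
apply: subset_leq_card; apply/subsetP => A; rewrite inE => /cards2P[a [b [ab ->]]].
exact/mem_edges/comp.
Qed.

(** * Combining the bounds *)

Lemma card_roots_gt1 z x : ~~ connect h z x -> 1 < #|comp_roots|.
Proof.
move=> zx; apply/card_gt1P; exists (root h z), (root h x).
split; try exact: root_in_comp_roots.
by rewrite (root_connect h_csym).
Qed.

Lemma leq_card_edges_unions :
    4 <= #|T| ->
    (forall x y, x != y -> (forall a, ~~ h x a) -> ~ forall a, ~~ h y a) ->
  #|T| <= #|edges| + #|nbhd_unions| /\
  (#|edges| + #|nbhd_unions| <= #|T| -> star_like).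
Proof.
move=> n4 isol1; have leE := leq_card_edges_roots.
have nbrP x : (exists y, h x y) \/ forall y, ~~ h x y.
  case: (pickP (h x)) => [y hy|no]; first by left; exists y.
  by right=> y; rewrite no.
have [z /forallP zisol|noz] := pickP (fun z => [forall x, ~~ h z x]).
  have nisol x : x != z -> exists y, h x y.
    by move=> xz; case: (nbrP x) => // xi; case: (isol1 x z xz xi zisol).
  have := leq_trans (leq_roots_unions_at nisol) (subset_leq_card (unions_at_sub z)).
  have [x xz] : exists x, x != z.
    have : 0 < #|[set~ z]| by rewrite cardsC1; lia.
    by case/card_gt0P => x; rewrite !inE; exists x.
  have : 1 < #|comp_roots|.
    apply: (@card_roots_gt1 z x); apply: contraNN xz => /connectP[[|a s]] /=.
      by move=> _ ->.
    by rewrite (negPf (zisol a)).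
  (* Here $m+s \ge (n-c)+2(c-1) = n+c-2 \ge n$, and equality forces $c = s = 2$ and $m = n-2$. *)
  move=> c2 leS; split; first lia.
  by move=> leT; apply: (star_isolated zisol nisol) => //; lia.
have nisol x : exists y, h x y.
  by case: (nbrP x) => // /forallP xi; move: (noz x); rewrite xi.
have [c2|c1] := ltnP 1 #|comp_roots|.
  suff : #|T| < #|edges| + #|nbhd_unions| by split; lia.
  case/card_gt1P: (c2) => z [r [zR rR zr]].
  have nzr : ~~ connect h z r.
    move: zR rR; rewrite !inE -(root_connect h_csym) => /eqP -> /eqP ->.
    exact: zr.
  have [z' hzz'] := nisol z.
  have nz'r : ~~ connect h z' r.
    by apply: contraNN nzr; apply: connect_trans; apply: connect1.
  (* One union more makes the bound strict: every member of [unions_at z] contains [z'], this one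
     does not. *)
  have new : nbhd z' :|: nbhd r \notin unions_at z.
    apply/imsetP => -[a _ /setP/(_ z')]; rewrite !inE hzz' h_irr /= => hrz'.
    by case/negP: nz'r; apply: connect1; rewrite h_sym.
  have : #|(nbhd z' :|: nbhd r) |: unions_at z| <= #|nbhd_unions|.
    apply: subset_leq_card; rewrite subUset unions_at_sub sub1set andbT.
    apply: mem_nbhd_unions; last by apply: contraNN nz'r => /connect1.
    by apply: contraNneq nz'r => ->; apply: connect0.
  rewrite cardsU1 new add1n.
  have le2c := @leq_roots_unions_at z (fun x _ => nisol x).
  by move/(leq_ltn_trans le2c); lia.
(* Now $m \ge n-1$, so two unions already give more than $n$. *)
have [S0|S1|S2] : [\/ #|nbhd_unions| = 0, #|nbhd_unions| = 1 | 1 < #|nbhd_unions|].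
- by case: #|nbhd_unions| => [|[|k]]; [constructor 1|constructor 2|constructor 3].
- by have := no_unions_complete n4 S0; split; lia.
- by split; [lia | move=> leT; apply: star_one_union => //; lia].
- by split; lia.
Qed.

End Graph.

(** * From the complement back to lines *)

Definition complement (T : finType) (e : rel T) : rel T :=
  fun a b => (a != b) && ~~ e a b.

(** The two kinds of lines never coincide: the line of an edge of $G$ contains both ends of that
    edge, while an edge of the complement is a pair of vertices not adjacent in $G$. *)
Lemma leq_card_lines (T : finType) (e : rel T) :
    symmetric e -> irreflexive e ->
  #|edges (complement e)| + #|nbhd_unions (complement e)| <= #|lines e|.
Proof.
move=> e_sym e_irr; set h := complement e.
have lineC a b : a != b -> e a b -> line e a b = ~: (nbhd h a :|: nbhd h b).
  move=> ab eab; apply/setP => c; rewrite /line /triangle !inE /h /complement ab eab /=.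
  case: (eqVneq c a) => [->|ca]; first by rewrite /= eq_sym ab e_sym eab.
  case: (eqVneq c b) => [->|cb]; first by rewrite /= eab.
  by case: (e a c); case: (e b c).
have lineN a b : h a b -> line e a b = [set a; b].
  case/andP=> ab /negPf nab; apply/setP => c.
  by rewrite /line /triangle !inE nab /= !andbF orbF.
rewrite -(card_imset (mem (nbhd_unions h)) (@setC_inj T)).
have dis : [disjoint edges h & [set ~: L | L in nbhd_unions h]].
  rewrite disjoint_subset; apply/subsetP => L /imsetP[[a b]]; rewrite !inE /= => hab ->.
  apply/imsetP => -[M /imsetP[[c d]]]; rewrite !inE /= => /andP[cd].
  rewrite /h /complement cd negbK /= => ecd -> E.
  have cin : c \in [set a; b] by rewrite E -lineC // /line !inE eqxx.
  have din : d \in [set a; b] by rewrite E -lineC // /line !inE eqxx orbT.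
  case/andP: hab => _ /negP; apply.
  case/set2P: cin cd ecd => ->; case/set2P: din => ->; rewrite ?eqxx //.
  by rewrite e_sym.
have -> : #|edges h| + #|[set ~: L | L in nbhd_unions h]|
          = #|edges h :|: [set ~: L | L in nbhd_unions h]|.
  by rewrite cardsU disjoint_setI0 // cards0 subn0.
apply: subset_leq_card; apply/subsetP => L /setUP[] /imsetP.
  case=> -[a b]; rewrite inE /= => hab ->.
  apply/imsetP; exists (a, b); last by rewrite /= lineN.
  by rewrite inE; case/andP: hab.
case=> M /imsetP[[a b]]; rewrite inE /= => /andP[ab].
rewrite /h /complement ab negbK /= => eab -> ->.
by apply/imsetP; exists (a, b); rewrite ?inE //= lineC.
Qed.

Theorem theorem3 (T : finType) (e : rel T)
    (e_sym : symmetric e) (e_irr : irreflexive e)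
    (n_ge4 : 4 <= #|T|)
    (no_universal : ~ exists2 L : {set T}, L \in lines e & universal L) :
  #|T| <= #|lines e| /\
  (#|lines e| = #|T| ->
   exists (K : {set T}) (v : T),
     [/\ clique e K, #|K| = #|T|.-1, v \notin K, v |: K = [set: T]
       & #|neighbors_in e v K| <= 1]).
Proof.
pose h := complement e.
have h_sym : symmetric h by move=> a b; rewrite /h /complement eq_sym e_sym.
have h_irr : irreflexive h by move=> a; rewrite /h /complement eqxx.
have le_lines : #|edges h| + #|nbhd_unions h| <= #|lines e|.
  exact: leq_card_lines.
(* Two isolated vertices of [h] are adjacent in $G$ to all others, so their line would be
   universal. *)
have isol1 x y : x != y -> (forall a, ~~ h x a) -> ~ forall a, ~~ h y a.
  move=> xy xi yi.
  have adj u a : ~~ h u a -> u != a -> e u a.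
    by rewrite /h /complement => + ua; rewrite ua negbK.
  apply: no_universal; exists (line e x y).
    by apply/imsetP; exists (x, y); rewrite ?inE.
  apply/eqP/setP => c; rewrite /line /triangle !inE xy (adj _ _ (xi y)) //=.
  case: (eqVneq c x) => //= cx; case: (eqVneq c y) => //= cy.
  by rewrite !adj // eq_sym.
have [leT star] := leq_card_edges_unions h_sym h_irr n_ge4 isol1.
split=> [|eT]; first exact: leq_trans leT le_lines.
have [|v [cov one]] := star; first by rewrite -eT.
exists [set~ v], v; split.
- move=> p q; rewrite !inE => pv qv pq; apply/idPn => npq.
  by case: (cov p q) => [|E|E]; rewrite /h /complement ?pq // -?E ?eqxx in pv qv *.
- by rewrite cardsC1.
- by rewrite !inE eqxx.
- exact: setUCr.
- apply/card_le1_eqP => p q; rewrite !inE => /andP[pv evp] /andP[qv evq].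
  by apply: one; rewrite // /h /complement ?evp ?evq andbF.
Qed.
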